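(* Let $\mathbb{F}$ be a field of characteristic $0$, $n\in\mathbb{N}$, and $\varkappa=(\varkappa_1,\ldots,\varkappa_n)\in\mathbb{N}^n$ (all $\varkappa_j\ge1$). Then the following identity holds in $\mathbb{F}(y_1,\ldots,y_n,t)$: \[ \frac{1}{\prod_{j=1}^{n}(1-y_j t)^{\varkappa_j}}=\sum_{s=1}^{n}\sum_{r=1}^{\varkappa_s}\frac{A_{y,\varkappa,s,r}}{(1-y_s t)^{r}}. \]
   Context: For variables $x_1,\ldots,x_N$ and $m\in\mathbb{N}_0$, $\operatorname{h}_m(x_1,\ldots,x_N)=\sum_{k\in\mathbb{N}_0^N,\ |k|=m} x_1^{k_1}\cdots x_N^{k_N}$. For $s\in\{1,\ldots,n\}$ and $r\in\{1,\ldots,\varkappa_s\}$, define \[ A_{y,\varkappa,s,r}=\frac{(-y_s)^{|\varkappa|-\varkappa_s}}{\prod_{d\in\{1,\ldots,n\}\setminus\{s\}}(y_d-y_s)^{\varkappa_d}}\;\operatorname{h}_{\varkappa_s-r}(w), \] where $|\varkappa|=\varkappa_1+\cdots+\varkappa_n$ and $w$ is the list obtained by listing, for $d=1,\ldots,n$ with $d\ne s$ in increasing order, the element $y_d/(y_d-y_s)$ repeated $\varkappa_d$ times. *)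

(* Defs.v *)
From HB Require Import structures.
From mathcomp Require Export all_boot all_order all_algebra.
From mathcomp Require Export fraction mpoly.

Set Implicit Arguments.
Unset Strict Implicit.
Unset Printing Implicit Defensive.

Import GRing.Theory.
Local Open Scope ring_scope.

(* Complete homogeneous symmetric polynomial h_m evaluated at x; the bound on
   the multi-indices only serves to make the index set finite. *)
Definition hsym (R : comNzRingType) (N m : nat) (x : N.-tuple R) : R :=
  \sum_(k : 'X_{1..N < m.+1} | mdeg k == m) \prod_(i < N) tnth x i ^+ k i.

Section Coefficients.

Variables (K : fieldType) (n : nat) (y : 'I_n -> K) (kappa : 'I_n -> nat).

(* enum 'I_n lists the indices in increasing order. *)
Definition wlist (s : 'I_n) : seq K :=
  flatten [seq nseq (kappa d) (y d / (y d - y s)) | d <- enum 'I_n & d != s].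

(* The natural subtraction in the exponent never truncates. *)
Definition Acoef (s : 'I_n) (r : nat) : K :=
  (- y s) ^+ (\sum_(j < n) kappa j - kappa s)
    / (\prod_(d < n | d != s) (y d - y s) ^+ kappa d)
    * hsym (kappa s - r) (in_tuple (wlist s)).

End Coefficients.

(* The field F(y_1, ..., y_n, t): the first n of the n + 1 indeterminates are
   the y_j, the last one is t. *)
Definition ratfun (F : fieldType) (n : nat) : fieldType :=
  {fraction {mpoly F[n.+1]}}.

Definition yvar (F : fieldType) (n : nat) (j : 'I_n) : ratfun F n :=
  tofrac ('X_(widen_ord (leqnSn n) j) : {mpoly F[n.+1]}).

Definition tvar (F : fieldType) (n : nat) : ratfun F n :=
  tofrac ('X_ord_max : {mpoly F[n.+1]}).

(* Main.v *)
(** The difference of both sides, multiplied by [\prod_j (1 - y_j T)^kappa_j],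
    is a polynomial in [T] of degree less than [|kappa|]. It vanishes as soon as
    each [(1 - y_s T)^kappa_s] divides it. With [X = 1 - y_s T], every factor
    [1 - y_d T] with [d != s] is a constant multiple of
    [1 - (y_d / (y_d - y_s)) X], so the divisibility is the generating series
    [\sum_m h_m(w) X^m = \prod_i (1 - w_i X)^-1] truncated at [X^kappa_s]. *)
Require Import Defs.
From mathcomp Require Import ring.

Set Implicit Arguments.
Unset Strict Implicit.
Unset Printing Implicit Defensive.

Import GRing.Theory.
Local Open Scope ring_scope.

(** Expanding the product chooses an exponent below [M] in each factor; the choices of total [m] are
    the multi-indices of degree [m], none of which is lost since [m < M]. *)
Lemma coef_prod_geometric (R : comNzRingType) (N M m : nat) (x : N.-tuple R) :
  (m < M)%N ->
  (\prod_(i < N) \sum_(j < M) (tnth x i *: 'X) ^+ j)`_m = hsym m x.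
Proof.
case: M => // M lt_mM; rewrite bigA_distr_bigA /= coef_sum.
transitivity (\sum_(f : {ffun 'I_N -> 'I_M.+1} | (\sum_i f i == m)%N)
    \prod_(i < N) tnth x i ^+ f i).
  rewrite [RHS]big_mkcond; apply: eq_bigr => f _.
  under eq_bigr do rewrite exprZn.
  rewrite scaler_prod prodrXr coefZ coefXn eq_sym.
  by case: ifP => _; rewrite ?mulr1 ?mulr0.
have bm_lt0 : (mdeg (0 : 'X_{1..N}) < m.+1)%N by rewrite mdeg0.
(* [h] and [h'] are mutually inverse between multi-indices of degree [m] and exponent choices of sum
   [m]; the defaults of [inord] and [insubd] are never reached there. *)
pose h (k : 'X_{1..N < m.+1}) : {ffun 'I_N -> 'I_M.+1} := [ffun i => inord (k i)].
pose h' (f : {ffun 'I_N -> 'I_M.+1}) : 'X_{1..N < m.+1} :=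
  insubd (BMultinom bm_lt0) [multinom (f i : nat) | i < N].
have h'E (f : {ffun 'I_N -> 'I_M.+1}) :
    (\sum_i f i == m)%N -> h' f = [multinom (f i : nat) | i < N] :> 'X_{1..N}.
  move=> /eqP sum_f; rewrite insubdK // unfold_in mdegE.
  by under eq_bigr do rewrite mnmE; rewrite sum_f.
have hE (k : 'X_{1..N < m.+1}) i : h k i = k i :> nat.
  rewrite ffunE inordK // (leq_trans _ lt_mM) // (leq_ltn_trans _ (bmdeg k)) //.
  by rewrite mdegE (bigD1 i) //= leq_addr.
rewrite (reindex_onto h h') /=; last first.
  move=> f sum_f; apply/ffunP => i; apply: val_inj.
  by rewrite /= hE h'E // mnmE.
rewrite /hsym; apply: eq_big => [k|k _]; last by apply: eq_bigr => i _; rewrite hE.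
have sum_hk : (\sum_i h k i = mdeg k)%N.
  by rewrite mdegE; apply: eq_bigr => i _; rewrite hE.
rewrite sum_hk; case: eqP => //= deg_k; apply/eqP/val_inj => /=.
rewrite h'E ?sum_hk ?deg_k //; apply/mnmP => i.
by rewrite mnmE hE.
Qed.

(** Modulo ['X^M] the sum is the product [G] of truncated geometric series, and each of these
    inverts its factor [1 - x_i X]. *)
Lemma dvdXn_hsym_series (K : fieldType) (N M : nat) (x : N.-tuple K) :
  'X^M %| (\sum_(m < M) hsym m x *: 'X^m)
            * \prod_(i < N) (1 - tnth x i *: 'X) - 1.
Proof.
set H := \sum_(m < M) _; set Q := \prod_(i < N) _.
pose G := \prod_(i < N) \sum_(j < M) (tnth x i *: 'X) ^+ j.
have ->: H = G %% 'X^M.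
  rewrite -Pdiv.IdomainMonic.take_poly_modp /H -(poly_def M (fun m => hsym m x)); apply/polyP => m.
  rewrite coef_poly coef_take_poly; case: ifP => // lt_mM.
  by rewrite coef_prod_geometric.
have ->: G %% 'X^M * Q - 1 = (G * Q - 1) - G %/ 'X^M * Q * 'X^M.
  by rewrite {2}(divp_eq G 'X^M); ring.
rewrite dvdp_sub ?dvdp_mull //.
rewrite /G /Q -big_split /=.
(* Being congruent to 1 modulo ['X^M] is stable under products, so one factor at a time suffices. *)
elim/big_ind: _ => [|p q dvd_p dvd_q|i _]; first by rewrite subrr dvdp0.
  have ->: p * q - 1 = p * (q - 1) + (p - 1) by ring.
  by rewrite dvdp_add // dvdp_mull.
set z := tnth x i *: 'X.
have ->: (\sum_(j < M) z ^+ j) * (1 - z) - 1 = - z ^+ M.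
  by rewrite -[z ^+ M](subrK 1) subrX1; ring.
by rewrite dvdpNr /z exprZn -mul_polyC dvdp_mull.
Qed.

Lemma dvdp_prod_coprime (K : fieldType) (I : eqType) (r : seq I)
    (p : I -> {poly K}) (q : {poly K}) :
  uniq r -> {in r &, forall i j, i != j -> coprimep (p i) (p j)} ->
  {in r, forall i, p i %| q} -> \prod_(i <- r) p i %| q.
Proof.
elim: r => [|i r IHr]; first by rewrite big_nil dvd1p.
move=> /= /andP[i_notin uniq_r] cop dvd; rewrite big_cons Gauss_dvdp.
  rewrite dvd ?mem_head // IHr // => [j k jr kr|j jr].
    by apply: cop; rewrite inE (jr, kr) orbT.
  by apply: dvd; rewrite inE jr orbT.
(* A second induction shows the head factor coprime to the product of the tail. *)
elim: r i_notin cop {IHr dvd uniq_r} => [|j r IHr]; first by rewrite big_nil coprimep1.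
rewrite inE negb_or big_cons coprimepMr => /andP[neq_ij i_notin] cop.
rewrite cop ?inE ?eqxx ?orbT //= IHr // => k l kr lr.
by apply: cop; rewrite !inE -?orbA orbCA -in_cons (kr, lr) orbT.
Qed.

Section Linear.

Variable K : fieldType.
Implicit Types a b : K.

Lemma size_one_subZX a : a != 0 -> size (1 - a *: 'X : {poly K}) = 2.
Proof.
move=> a_neq0; rewrite addrC size_polyDl ?size_polyN ?size_scale ?size_polyX //.
by rewrite size_poly1.
Qed.

Lemma coprimep_one_subZX a b :
  a != b -> coprimep (1 - a *: 'X) (1 - b *: 'X : {poly K}).
Proof.
move=> neq_ab; apply/Bezout_coprimepP; exists (- b%:P, a%:P) => /=.
have ->: - b%:P * (1 - a *: 'X) + a%:P * (1 - b *: 'X) = (a - b)%:P.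
  by rewrite -!mul_polyC rmorphB /=; ring.
by rewrite -size_poly_eq1 size_polyC subr_eq0 neq_ab.
Qed.

Lemma size_prod_one_subZX (I : Type) (r : seq I) (P : pred I) (y : I -> K)
    (e : I -> nat) :
  (forall i, y i != 0) ->
  size (\prod_(i <- r | P i) (1 - y i *: 'X) ^+ e i) =
  (\sum_(i <- r | P i) e i).+1.
Proof.
move=> y_neq0.
elim/big_ind2: _ => [|p m q k size_p size_q|i _]; first by rewrite size_poly1.
  rewrite size_mul -?size_poly_eq0 ?size_p ?size_q //.
  by rewrite addSn addnS.
have := size_exp (1 - y i *: 'X) (e i); rewrite size_one_subZX // mul1n.
have: (1 - y i *: 'X) ^+ e i != 0.
  by rewrite expf_neq0 // -size_poly_eq0 size_one_subZX.
by rewrite -size_poly_gt0; case: size => //= k _ ->.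
Qed.

End Linear.

Section PartialFractions.

Variables (K : fieldType) (n : nat) (y : 'I_n -> K) (kappa : 'I_n -> nat).
Hypotheses (y_inj : injective y) (y_neq0 : forall j, y j != 0).

Local Notation L j := (1 - y j *: 'X : {poly K}).
Local Notation Q s := (\prod_(d < n | d != s) L d ^+ kappa d).

(** For [w = y_d / (y_d - y_s)] and [X = 1 - y_s T], one has [(y_d - y_s) (1 - w X) = - y_s (1 - y_d
    T)]. The constants collected over [d != s] form the prefactor of [Acoef]. *)
Lemma prod_wlist (s : 'I_n) :
  let w := in_tuple (wlist y kappa s) in
  \prod_(i < size (wlist y kappa s)) (1 - tnth w i *: 'X) \Po L s =
  ((- y s) ^+ (\sum_(j < n) kappa j - kappa s)
    / (\prod_(d < n | d != s) (y d - y s) ^+ kappa d)) *: Q s.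
Proof.
rewrite /=.
rewrite -(big_tuple _ _ (in_tuple (wlist y kappa s)) xpredT (fun a => 1 - a *: 'X)).
rewrite /= big_flatten big_map big_filter big_enum_cond /= rmorph_prod /=.
rewrite [X in (X - _)%N](bigD1 s) //= addKn -prodrXr -prodf_div -scaler_prod.
apply: eq_bigr => d neq_ds.
rewrite big_nseq iter_mulr_1 rmorphXn /= -expr_div_n -exprZn; congr (_ ^+ _).
have y_sub : y d - y s != 0 by rewrite subr_eq0 (inj_eq y_inj).
rewrite comp_polyB comp_polyZ comp_polyX comp_polyC.
apply: (@scalerI _ _ (y d - y s)) => //.
rewrite scalerBr !scalerA 2!(mulrC (y d - y s)) !divfK //.
by rewrite -!mul_polyC !rmorphN /= rmorphB /=; ring.
Qed.

(** This is the truncated series divisibility composed with [L s], the term of degree [m]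
    corresponding to [r = kappa s - m]. *)
Lemma dvd_one_sub_local_part (s : 'I_n) :
  L s ^+ kappa s %|
    1 - (\sum_(1 <= r < (kappa s).+1) Acoef y kappa s r *: L s ^+ (kappa s - r)) * Q s.
Proof.
have := dvdp_comp_poly (L s) (dvdXn_hsym_series (kappa s) (in_tuple (wlist y kappa s))).
rewrite comp_polyB comp_polyM comp_polyC prod_wlist comp_Xn_poly.
rewrite -dvdpNr opprB; congr (_ %| 1 - _).
rewrite -scalerAr scalerAl; congr (_ * _).
rewrite raddf_sum /= scaler_sumr big_add1 /= big_mkord (reindex_inj rev_ord_inj) /=.
by apply: eq_bigr => i _; rewrite comp_polyZ comp_Xn_poly scalerA.
Qed.

Lemma poly_partial_fraction : (0 < n)%N -> (forall j, (0 < kappa j)%N) ->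
  \sum_(s < n)
    (\sum_(1 <= r < (kappa s).+1) Acoef y kappa s r *: L s ^+ (kappa s - r)) * Q s
  = 1.
Proof.
move=> n_gt0 kappa_gt0; set S := \sum_(s < n) _.
(* A nonzero difference would have size at least [|kappa| + 1] by divisibility, against the bound
   [|kappa|] obtained from its terms. *)
apply/esym/eqP; rewrite -subr_eq0; apply: contraT => neq0.
have: \prod_(j < n) L j ^+ kappa j %| 1 - S.
  apply: dvdp_prod_coprime => [|i j _ _ neq_ij|s _]; first exact: index_enum_uniq.
    by rewrite coprimep_expl // coprimep_expr // coprimep_one_subZX // (inj_eq y_inj).
  (* Only the summand of index [s] needs the local statement: for [d != s], the cofactor [Q d]
     contains [L s ^+ kappa s]. *)
  rewrite /S (bigD1 s) //= opprD addrA dvdp_sub ?dvd_one_sub_local_part //.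
  elim/big_ind: _ => [|p q dvd_p dvd_q|d neq_ds]; rewrite ?dvdp0 ?dvdp_add //.
  by rewrite dvdp_mull // (bigD1 s) 1?eq_sym //= dvdp_mulr.
move/(dvdp_leq neq0); rewrite size_prod_one_subZX // ltnNge => /negP[].
have kappa_le s : (kappa s <= \sum_(j < n) kappa j)%N.
  by rewrite (bigD1 s) //= leq_addr.
rewrite (leq_trans (size_polyD _ _)) // size_polyN geq_max size_poly1; apply/andP; split.
  exact: leq_trans (kappa_gt0 (Ordinal n_gt0)) (kappa_le _).
apply: (leq_trans (size_sum _ _ _)); apply/bigmax_leqP => s _.
rewrite mulr_suml big_add1 /= big_mkord.
apply: (leq_trans (size_sum _ _ _)); apply/bigmax_leqP => r _.
rewrite -scalerAl (leq_trans (size_scale_leq _ _)) //.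
(* Each term is a single product of linear powers. As [r] now starts at 0, the exponent at [s] drops
   by [r.+1 > 0], which makes the degree strictly less than [|kappa|]. *)
pose e d := if d == s then (kappa s - r.+1)%N else kappa d.
have ->: L s ^+ (kappa s - r.+1) * Q s = \prod_(d < n) L d ^+ e d.
  rewrite [RHS](bigD1 s) //= /e eqxx; congr (_ * _).
  by apply: eq_bigr => d /negPf ->.
rewrite size_prod_one_subZX // (bigD1 s) //= [leqRHS](bigD1 s) //= /e eqxx.
rewrite -addSn leq_add ?ltn_subrL ?kappa_gt0 //.
by apply: leq_sum => d /negPf ->.
Qed.

(** Evaluate the polynomial identity at [t] and divide by the full product; in each term [Q s] and
    the power [kappa s - r] of [1 - y_s t] cancel. *)
Lemma partial_fraction (t : K) :
  (0 < n)%N -> (forall j, (0 < kappa j)%N) -> (forall j, 1 - y j * t != 0) ->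
  1 / (\prod_(j < n) (1 - y j * t) ^+ kappa j)
  = \sum_(s < n) \sum_(1 <= r < (kappa s).+1)
      Acoef y kappa s r / (1 - y s * t) ^+ r.
Proof.
move=> n_gt0 kappa_gt0 L_neq0.
have LE j : (L j).[t] = 1 - y j * t by rewrite !hornerE.
set D := \prod_(j < n) _.
have ->: 1 / D = (1 : {poly K}).[t] / D by rewrite hornerC.
rewrite -poly_partial_fraction // horner_sum mulr_suml.
apply: eq_bigr => s _; rewrite hornerM horner_prod !big_add1 /= !big_mkord.
rewrite horner_sum !mulr_suml; apply: eq_bigr => r _.
under eq_bigr do rewrite horner_exp LE.
rewrite hornerZ horner_exp LE /D [X in _ / X](bigD1 s) //=.
have ->: (1 - y s * t) ^+ kappa s
    = (1 - y s * t) ^+ (kappa s - r.+1) * (1 - y s * t) ^+ r.+1.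
  by rewrite -exprD subnK.
have Q_neq0 : \prod_(d < n | d != s) (1 - y d * t) ^+ kappa d != 0.
  by apply/prodf_neq0 => d _; rewrite expf_neq0.
have := expf_neq0 r.+1 (L_neq0 s); have := expf_neq0 (kappa s - r.+1) (L_neq0 s).
move: Q_neq0; set q := \prod_(d < n | _) _; set a := _ ^+ (_ - _); set b := _ ^+ r.+1.
by move=> *; field; apply/and3P.
Qed.

End PartialFractions.

Theorem theorem8p5 (F : fieldType) (char0 : [pchar F] =i pred0)
    (n : nat) (n_gt0 : (0 < n)%N)
    (kappa : 'I_n -> nat) (kappa_gt0 : forall j, (0 < kappa j)%N) :
  let y := @yvar F n in
  let t := tvar F n in
  1 / (\prod_(j < n) (1 - y j * t) ^+ kappa j)
  = \sum_(s < n) \sum_(1 <= r < (kappa s).+1)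
      Acoef y kappa s r / (1 - y s * t) ^+ r.
Proof.
move=> y t.
(* Polynomials embed injectively into fractions, so one evaluation point with distinct values
   separates two of them. *)
have neq_eval (v : 'I_n.+1 -> F) (p q : {mpoly F[n.+1]}) :
    p.@[v] != q.@[v] -> tofrac p != tofrac q.
  by apply: contraNneq => /eqP; rewrite tofrac_eq => /eqP ->.
apply: partial_fraction => // [i j|j|j].
- apply: contra_eq => neq_ij.
  (* At the point with [y_i = 1] and all other coordinates 0, [y_i] and [y_j] differ. *)
  apply: (neq_eval (fun k => (k == widen_ord (leqnSn n) i)%:R)).
  rewrite !mevalXU eqxx [_ == widen_ord _ i]eq_sym -val_eqE /= val_eqE (negPf neq_ij).
  exact: oner_neq0.
- rewrite -tofrac0; apply: (neq_eval (fun=> 1)).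
  by rewrite mevalXU meval0 oner_neq0.
(* At the origin [1 - y_j t] takes the value 1. *)
- rewrite -tofrac1 -tofracM -tofracB -tofrac0; apply: (neq_eval (fun=> 0)).
  by rewrite mevalB mevalM meval1 meval0 !mevalXU mulr0 subr0 oner_neq0.
Qed.
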